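(* Up to isomorphism, there are exactly 3 minimal obstructions to $C_5$-coloring among $S_{2,2,1}$-free graphs, and exactly 5 minimal obstructions to $C_5$-coloring among $S_{3,1,1}$-free graphs.
   Context: All graphs are finite and simple. For graphs $G$ and $H$, an $H$-coloring of $G$ is a map $c: V(G)\to V(H)$ such that $c(u)c(v)\in E(H)$ for every edge $uv\in E(G)$. A graph $G$ is a minimal obstruction to $H$-coloring if $G$ has no $H$-coloring but every proper induced subgraph of $G$ has an $H$-coloring. $C_5$ is the cycle on five vertices. For integers $a,b,c\ge 1$, $S_{a,b,c}$ is the graph obtained from the paths $P_{a+1},P_{b+1},P_{c+1}$ (where $P_t$ is the path on $t$ vertices) by identifying one endvertex of each of them into a single vertex. A graph is $F$-free if it does not contain $F$ as an induced subgraph. *)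

(* Defs.v *)
From mathcomp Require Import all_boot.

Set Implicit Arguments.
Unset Strict Implicit.
Unset Printing Implicit Defensive.

Record sgraph := SGraph {
  vertex :> finType;
  adj : rel vertex;
  adj_sym : symmetric adj;
  adj_irrefl : irreflexive adj }.

Section Induced.
Variables (G : sgraph) (S : {set G}).

Definition induced_adj : rel {x : G | x \in S} :=
  fun u v => adj (val u) (val v).

Lemma induced_adj_sym : symmetric induced_adj.
Proof. by move=> u v; apply: adj_sym. Qed.

Lemma induced_adj_irrefl : irreflexive induced_adj.
Proof. by move=> u; apply: adj_irrefl. Qed.

Definition induced : sgraph := SGraph induced_adj_sym induced_adj_irrefl.

End Induced.

Definition isomorphic (G H : sgraph) : Prop :=
  exists f : G -> H, bijective f /\ forall u v : G, adj (f u) (f v) = adj u v.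

Definition free_of (F G : sgraph) : Prop :=
  ~ exists S : {set G}, isomorphic F (induced S).

Definition colorable (H G : sgraph) : Prop :=
  exists c : G -> H, forall u v : G, adj u v -> adj (c u) (c v).

Definition minimal_obstruction (H G : sgraph) : Prop :=
  ~ colorable H G /\
  forall S : {set G}, S \proper [set: G] -> colorable H (induced S).

Definition C5_adj : rel 'I_5 :=
  fun i j => (i.+1 %% 5 == j) || (j.+1 %% 5 == i).

Lemma C5_adj_sym : symmetric C5_adj.
Proof. by move=> i j; apply: orbC. Qed.

Lemma C5_adj_irrefl : irreflexive C5_adj.
Proof. by case=> [[|[|[|[|[|]]]]]]. Qed.

Definition C5 : sgraph := SGraph C5_adj_sym C5_adj_irrefl.

Definition consecutive (i j : nat) : bool := (i.+1 == j) || (j.+1 == i).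

Section Spider.
Variables a b c : nat.

(* None is the common endvertex of the three paths; the index i on a leg is   *)
(* the vertex at distance i.+1 from it.                                       *)
Definition S_adj : rel (option ('I_a + 'I_b + 'I_c)) :=
  fun u v => match u, v with
  | None, Some (inl (inl i)) | Some (inl (inl i)), None => val i == 0
  | None, Some (inl (inr i)) | Some (inl (inr i)), None => val i == 0
  | None, Some (inr i) | Some (inr i), None => val i == 0
  | Some (inl (inl i)), Some (inl (inl j)) => consecutive i j
  | Some (inl (inr i)), Some (inl (inr j)) => consecutive i j
  | Some (inr i), Some (inr j) => consecutive i j
  | _, _ => false
  end.

Lemma S_adj_sym : symmetric S_adj.
Proof. by move=> [[[i|i]|i]|] [[[j|j]|j]|] //=; apply: orbC. Qed.

Lemma S_adj_irrefl : irreflexive S_adj.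
Proof.
by move=> [[[i|i]|i]|] //=; rewrite /consecutive orbb; apply: gtn_eqF.
Qed.

Definition S_graph : sgraph := SGraph S_adj_sym S_adj_irrefl.

End Spider.

Definition exactly_up_to_iso (n : nat) (P : sgraph -> Prop) : Prop :=
  exists g : 'I_n -> sgraph,
    [/\ forall i, P (g i),
        forall i j, isomorphic (g i) (g j) -> i = j
      & forall G, P G -> exists i, isomorphic G (g i)].

(* Main.v *)
Require Import Defs.
From mathcomp Require Import all_boot.

(* Let G be a minimal obstruction and H an induced subgraph of G. Since a     *)
(* colouring of a proper subgraph can be pulled back along an endomorphism of *)
(* G, every endomorphism of G is surjective; so if some vertices of H can be  *)
(* folded onto others inside H, then G has a vertex outside H that prevents   *)
(* the folding. Likewise, if every colouring of H - X extends to X, then G has*)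
(* a vertex outside H with a neighbour in X: this gives connectivity (X = H), *)
(* and, because any two vertices of C5 are joined by a walk of length 4, it   *)
(* excludes three consecutive vertices of degree two.                         *)
(* Starting from a single vertex and adding the forced vertices one by one, in*)
(* all possible ways, one reaches after finitely many steps a graph containing*)
(* the forbidden spider or one of the listed obstructions. The trees of cases *)
(* are small enough to be checked by computation.                             *)

(** A non-colorable induced subgraph of a minimal obstruction G is all of G
    ([uncolorable_copy_full]). So it is enough that every spider-free G contains a listed graph, and
    that the listed graphs are spider-free, minimal and pairwise non-isomorphic. The first point is
    an unavoidability argument. For an induced subgraph g of G, [fold_neighbor] and
    [extend_neighbor] produce a vertex outside g with a restricted adjacency to g. If each graph
    obtained by adding such a vertex contains the spider, a listed graph or a graph already treated,
    then g is treated too. [certifies_sound] carries this back to a single vertex, which every G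
    contains. The second point is a finite check: [critical_minimal] for minimality, [contains] for
    the rest. [classification] reduces both to the boolean [classifies], evaluated on explicit
    certificates. *)

Set Implicit Arguments.
Unset Strict Implicit.
Unset Printing Implicit Defensive.

(** * Codes of finite induced subgraphs *)

(* Row i lists the adjacency of vertex i to the vertices i+1, i+2, ..., so    *)
(* that adding a new vertex (as vertex 0) is a cons.                          *)
Notation code := (seq (seq bool)).

Fixpoint encode (T : Type) (e : rel T) (s : seq T) : code :=
  if s is x :: s' then [seq e x y | y <- s'] :: encode e s' else [::].

Definition encodes (T : eqType) (e : rel T) (g : code) (s : seq T) : bool :=
  uniq s && (encode e s == g).

Fixpoint code_adj (g : code) (i j : nat) : bool :=
  match g, i, j with
  | r :: _, 0, j'.+1 => nth false r j'
  | r :: _, i'.+1, 0 => nth false r i'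
  | _ :: g', i'.+1, j'.+1 => code_adj g' i' j'
  | _, _, _ => false
  end.

Lemma code_adj_sym g : symmetric (code_adj g).
Proof. by elim: g => [|r g IHg] [|i] [|j] //=. Qed.

Lemma code_adj_irrefl g : irreflexive (code_adj g).
Proof. by elim: g => [|r g IHg] [|i] //=. Qed.

Definition decode (g : code) : sgraph :=
  @SGraph 'I_(size g) (fun i j => code_adj g i j)
    (fun i j => code_adj_sym g i j) (fun i => code_adj_irrefl g i).

Lemma encodes_uniq (T : eqType) (e : rel T) g s : encodes e g s -> uniq s.
Proof. by case/andP. Qed.

Lemma encodes_size (T : eqType) (e : rel T) g s :
  encodes e g s -> size s = size g.
Proof. by case/andP=> _ /eqP <-; elim: s => //= x s ->. Qed.

Lemma encodes_cons (T : eqType) (e : rel T) r g x s :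
  encodes e (r :: g) (x :: s) =
  [&& [seq e x y | y <- s] == r, x \notin s & encodes e g s].
Proof.
by rewrite /encodes /= eqseq_cons; case: (_ \notin _); case: (_ == r);
   rewrite /= ?andbF.
Qed.

Lemma encodes_drop (T : eqType) (e : rel T) n g s :
  encodes e g s -> encodes e (drop n g) (drop n s).
Proof.
case/andP=> s_uniq /eqP <-; rewrite /encodes drop_uniq //=; apply/eqP.
by elim: n s {s_uniq} => [|n IHn] [|x s] //=; rewrite !drop0.
Qed.

Lemma encodes_code_adj (T : eqType) (e : rel T) g s x0 i j :
    symmetric e -> irreflexive e -> encodes e g s ->
    i < size s -> j < size s ->
  code_adj g i j = e (nth x0 s i) (nth x0 s j).
Proof.
move=> e_sym e_irr /andP[_ /eqP <-].
elim: s i j => [|x s IHs] // [|i] [|j] /= i_s j_s; last exact: IHs.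
- by rewrite e_irr.
- by rewrite (nth_map x0).
- by rewrite (nth_map x0) // e_sym.
Qed.

Lemma encodes_map (T T' : eqType) (e : rel T) (e' : rel T') (f : T -> T') g s :
    {in s &, injective f} -> {in s &, forall x y, e' (f x) (f y) = e x y} ->
  encodes e' g (map f s) = encodes e g s.
Proof.
move=> f_inj f_adj; rewrite /encodes (map_inj_in_uniq f_inj).
congr (_ && (_ == _)).
elim: s {f_inj} f_adj => //= x s IHs f_adj; congr (_ :: _).
  rewrite -map_comp; apply/eq_in_map => y y_s /=.
  by apply: f_adj; rewrite inE ?eqxx ?y_s ?orbT.
by apply: IHs => y z y_s z_s; apply: f_adj; rewrite inE ?y_s ?z_s orbT.
Qed.

(* The pattern p is in reverse order: its vertices are placed from the last   *)
(* one to the first, and s lists the positions already chosen.                *)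
Fixpoint find_copy (p g : code) (s : seq nat) : bool :=
  if p is r :: p' then
    has (fun i => [&& [seq code_adj g i j | j <- s] == r, i \notin s
                    & find_copy p' g (i :: s)]) (iota 0 (size g))
  else true.

Definition contains (h g : code) : bool := find_copy (rev h) g [::].

Lemma find_copy_sound p h g s :
    all (gtn (size g)) s -> encodes (code_adj g) h s -> find_copy p g s ->
  exists2 s', all (gtn (size g)) s' & encodes (code_adj g) (catrev p h) s'.
Proof.
elim: p h s => [|r p IHp] h s s_g s_h /=; first by exists s.
case/hasP=> i; rewrite mem_iota => /= i_g /and3P[i_r i_s].
by apply: IHp; rewrite /= ?i_g ?encodes_cons ?i_r ?i_s.
Qed.

Lemma find_copy_complete p h g s :
    all (gtn (size g)) s -> encodes (code_adj g) (catrev p h) s ->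
  find_copy p g (drop (size p) s).
Proof.
move=> s_g; elim: p h => //= r p IHp h s_ph; apply/hasP.
have /= := encodes_drop (size p) s_ph; have := IHp _ s_ph.
rewrite catrevE drop_size_cat ?size_rev //.
case def_s: (drop (size p) s) => [|i s'] // find_p.
have -> : drop (size p).+1 s = s' by rewrite -add1n -drop_drop def_s drop1.
 rewrite encodes_cons => /and3P[i_r i_s _]; exists i.
  rewrite mem_iota /= add0n; apply: (allP s_g); apply: (@mem_drop (size p)).
  by rewrite def_s mem_head.
by rewrite i_r i_s.
Qed.

Lemma containsP h g :
  reflect (exists2 s, all (gtn (size g)) s & encodes (code_adj g) h s)
          (contains h g).
Proof.
apply: (iffP idP) => [/(@find_copy_sound _ [::]) | [s s_g s_h]].
  by case=> // s; rewrite catrevE revK cats0; exists s.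
(* The search starts with no vertex placed: the empty list is [s] with all its positions dropped. *)
rewrite /contains -[[::]](drop_size s) (encodes_size s_h) -(size_rev h).
by apply: (@find_copy_complete _ [::]); rewrite ?catrevE ?revK ?cats0.
Qed.

(** * Copies of coded graphs inside an abstract graph *)

Section InGraph.
Variable G : sgraph.
Implicit Types (g h : code) (t : seq G).
Local Notation copy := (encodes (@adj G)).

Lemma copy_code_adj g t x0 i j : copy g t -> i < size g -> j < size g ->
  code_adj g i j = adj (nth x0 t i) (nth x0 t j).
Proof.
by move=> t_g; rewrite -(encodes_size t_g);
   apply: encodes_code_adj t_g; [apply: adj_sym | apply: adj_irrefl].
Qed.

Lemma contains_copy h g t (x0 : G) :
  copy g t -> contains h g -> exists t', copy h t'.
Proof.
move=> t_g /containsP[s /allP s_g s_h]; exists [seq nth x0 t i | i <- s].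
rewrite (@encodes_map _ _ (code_adj g)) // => i j /s_g /= i_g /s_g /= j_g.
  move/eqP; rewrite nth_uniq ?(encodes_size t_g) ?(encodes_uniq t_g) //.
  by move/eqP.
by rewrite -(copy_code_adj _ t_g).
Qed.

Lemma copy_contains h g t t' :
  copy g t -> (forall x, x \in t) -> copy h t' -> contains h g.
Proof.
move=> t_g t_full t'_h; apply/containsP; exists [seq index x t | x <- t'].
  by apply/allP => _ /mapP[x _ ->] /=; rewrite -(encodes_size t_g) index_mem.
rewrite (@encodes_map _ _ (@adj G)) // => x y _ _.
  by move=> eq_xy; rewrite -[x](nth_index x (t_full x)) eq_xy nth_index.
by rewrite (copy_code_adj x t_g) -?(encodes_size t_g) ?index_mem ?nth_index.
Qed.

Lemma full_copy_iso g t :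
  copy g t -> (forall x, x \in t) -> isomorphic G (decode g).
Proof.
move=> t_g t_full.
have idx_g x : index x t < size g by rewrite -(encodes_size t_g) index_mem.
exists (fun x => Ordinal (idx_g x)); split; last first.
  by move=> x y /=; rewrite (copy_code_adj x t_g) ?nth_index.
apply: inj_card_bij => [x y [eq_xy]|].
  by rewrite -[x](nth_index x (t_full x)) eq_xy nth_index.
rewrite card_ord -(encodes_size t_g) -(card_uniqP (encodes_uniq t_g)).
exact: max_card.
Qed.

Lemma lift_seq (S : {set G}) t :
  {subset t <= S} -> exists t' : seq (induced S), map val t' = t.
Proof.
elim: t => [|x t IHt] tS; first by exists [::].
have [|t' <-] := IHt; first by move=> y y_t; apply: tS; rewrite inE y_t orbT.
have xS : x \in S by apply: tS; rewrite mem_head.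
by exists (exist _ x xS :: t').
Qed.

Lemma copy_induced (S : {set G}) g (t : seq (induced S)) :
  encodes (@adj (induced S)) g t = copy g (map val t).
Proof.
by rewrite (@encodes_map _ _ (@adj (induced S))) // => x y _ _ /val_inj.
Qed.

End InGraph.

Lemma isomorphic_sym G H : isomorphic G H -> isomorphic H G.
Proof.
case=> f [[f' fK f'K] f_adj]; exists f'; split; first by exists f.
by move=> u v; rewrite -f_adj !f'K.
Qed.

Lemma isomorphic_trans G H K :
  isomorphic G H -> isomorphic H K -> isomorphic G K.
Proof.
move=> [f [f_bij f_adj]] [k [k_bij k_adj]]; exists (k \o f).
by split=> [|u v /=]; [apply: bij_comp | rewrite k_adj f_adj].
Qed.

Lemma isomorphic_copy (G H : sgraph) g (t : seq G) :
  isomorphic G H -> encodes (@adj G) g t -> exists t', encodes (@adj H) g t'.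
Proof.
case=> f [/bij_inj f_inj f_adj] t_g; exists (map f t).
by rewrite (@encodes_map _ _ (@adj G)) // => x y _ _ /f_inj.
Qed.

Lemma free_ofP (F G : sgraph) (h : code) (t : seq F) :
    encodes (@adj F) h t -> (forall x, x \in t) ->
  (forall t' : seq G, ~~ encodes (@adj G) h t') <-> free_of F G.
Proof.
move=> t_h t_full; split=> [no_h [S] | F_free t'].
  case/isomorphic_copy/(_ t_h)=> t'; rewrite copy_induced.
  exact/negP.
apply/negP=> t'_h; apply: F_free; exists [set x in t'].
apply: (isomorphic_trans (full_copy_iso t_h t_full)); apply: isomorphic_sym.
have [|s def_t'] := @lift_seq G [set x in t'] t'.
  by move=> x; rewrite inE.
apply: (@full_copy_iso _ _ s); first by rewrite copy_induced def_t'.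
by move=> x; rewrite -(mem_map val_inj) def_t' -[_ \in t']in_set (valP x).
Qed.

Lemma encode_decode g :
  encode (code_adj g) (iota 0 (size g)) == g ->
  encodes (@adj (decode g)) g (enum 'I_(size g)).
Proof.
move=> g_ok; rewrite -(@encodes_map _ _ _ (code_adj g) val).
- by rewrite val_enum_ord /encodes iota_uniq.
- by move=> i j _ _ /val_inj.
- by [].
Qed.

(** * Colourings of codes *)

Definition C5_rel (c d : nat) : bool := (c.+1 %% 5 == d) || (d.+1 %% 5 == c).

Definition color_ok (c : nat) (r : seq bool) (cs : seq nat) : bool :=
  all2 (fun (b : bool) d => b ==> C5_rel c d) r cs.

Fixpoint extensions (h : code) (cs : seq nat) : seq (seq nat) :=
  if h is r :: h' then
    [seq x.1 :: x.2 | x <- [seq (c, ds) | ds <- extensions h' cs, c <- iota 0 5]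
                    & color_ok x.1 r x.2]
  else [:: cs].

Definition colorings (g : code) : seq (seq nat) := extensions g [::].

Lemma extensions_consP r h cs ds :
  reflect (exists c ds', [/\ ds = c :: ds', c < 5, color_ok c r ds'
                           & ds' \in extensions h cs])
          (ds \in extensions (r :: h) cs).
Proof.
apply: (iffP mapP) => [[x] | [c [ds' [-> c5 c_ok ds'_ext]]]].
  rewrite mem_filter => /andP[x_ok /allpairsP[[ds' c] [ds'_ext c5 def_x]] ->].
  by move: x_ok; rewrite def_x; exists c, ds'; rewrite mem_iota in c5.
exists (c, ds') => //; rewrite mem_filter c_ok; apply/allpairsP.
by exists (ds', c); rewrite mem_iota.
Qed.

Definition proper_on (G : sgraph) (A : {pred G}) (c : G -> 'I_5) : Prop :=
  {in A &, forall x y, adj x y -> C5_adj (c x) (c y)}.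

Lemma colorable_inducedP (G : sgraph) (S : {set G}) :
  colorable C5 (induced S) <-> exists c, proper_on S c.
Proof.
split=> [[c c_ok] | [c c_ok]]; last first.
  by exists (fun u => c (val u)) => u v; apply: c_ok; apply: valP.
(* The color [ord0] outside [S] is arbitrary, since [proper_on] constrains only edges inside [S]. *)
exists (fun x => if insub x is Some u then c u else ord0) => x y xS yS adj_xy.
rewrite (insubT (fun x => x \in S) xS) (insubT (fun x => x \in S) yS).
exact: c_ok.
Qed.

Section Colorings.
Variable G : sgraph.
Implicit Types (g h : code) (t : seq G).
Local Notation copy := (encodes (@adj G)).

Lemma color_okP (c : G -> 'I_5) k x t :
  reflect {in t, forall y, adj x y -> C5_rel k (c y)}
          (color_ok k [seq adj x y | y <- t] [seq val (c y) | y <- t]).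
Proof.
rewrite /color_ok all2E !size_map eqxx /=.
rewrite zip_map all_map; apply: (iffP allP) => ok y /ok /=.
  by move/implyP.
by move=> {}ok; apply/implyP.
Qed.

Lemma coloring_mem g t (c : G -> 'I_5) :
  copy g t -> proper_on (mem t) c -> [seq val (c x) | x <- t] \in colorings g.
Proof.
elim: t g => [|x t IHt] [|r g]; [by rewrite inE | by [] | by case/andP |].
rewrite encodes_cons => /and3P[/eqP<- x_t t_g] c_ok.
apply/extensions_consP; exists (val (c x)), [seq val (c y) | y <- t].
split=> //; first exact: ltn_ord; last first.
  by apply: IHt t_g _ => y z y_t z_t; apply: c_ok; rewrite inE ?y_t ?z_t orbT.
by apply/color_okP=> y y_t; apply: c_ok; rewrite inE ?eqxx ?y_t ?orbT.
Qed.

(** Turns a computed extension into a recoloring of [t1] alone. That [c'] agrees with [c] off [t1]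
    is what later preserves properness on the rest of G. *)
Lemma extension_coloring h g t1 t2 (c : G -> 'I_5) ds :
    size t1 = size h -> copy (h ++ g) (t1 ++ t2) -> proper_on (mem t2) c ->
    ds \in extensions h [seq val (c x) | x <- t2] ->
  exists c' : G -> 'I_5,
    [/\ {in [predC t1], c' =1 c}, proper_on (mem (t1 ++ t2)) c'
      & ds = [seq val (c' x) | x <- t1 ++ t2]].
Proof.
elim: h t1 ds => [|r h IHh] [|x t1] ds //=.
  by move=> _ _ c_ok; rewrite inE => /eqP->; exists c.
case=> sz; rewrite encodes_cons => /and3P[/eqP<- x_t t_hg] c_ok.
case/extensions_consP=> k [ds' [-> k5 k_ok /(IHh _ _ sz t_hg c_ok)]].
case=> c' [c'_c c'_ok def_ds'].
have c_t y : y \in t1 ++ t2 -> (y == x) = false.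
  by apply: contraTF => /eqP->.
exists (fun y => if y == x then Ordinal k5 else c' y); split=> [y||] /=.
- by rewrite !inE negb_or => /andP[/negPf-> /c'_c].
- move: k_ok; rewrite def_ds' => /color_okP k_ok y z.
  rewrite !inE; case: eqP => [->|_] /=; case: eqP => [->|_] //=.
  + by rewrite adj_irrefl.
  + by move=> _ z_t; apply: k_ok.
  + move=> y_t _; rewrite adj_sym => /k_ok -/(_ y_t).
    by rewrite /C5_adj orbC.
  + exact: c'_ok.
- rewrite eqxx; congr (_ :: _); rewrite def_ds'.
  by apply/eq_in_map => y /c_t ->.
Qed.

End Colorings.

(** * Reducible configurations *)

Section Minimal.
Variables (G : sgraph) (G_min : minimal_obstruction C5 G).
Implicit Types (g h : code) (t : seq G).
Local Notation copy := (encodes (@adj G)).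

Lemma not_proper_on_full (c : G -> 'I_5) : ~ proper_on predT c.
Proof.
by case: G_min => G_col _ c_ok; apply: G_col; exists c => x y; apply: c_ok.
Qed.

Lemma minimal_coloring (A : {pred G}) x :
  x \in A -> exists c, proper_on [predC A] c.
Proof.
case: G_min => _ /(_ [set y | y \notin A]) colA xA.
have [|c c_ok] := (colorable_inducedP [set y | y \notin A]).1; last first.
  by exists c => y z; rewrite !inE => yA zA; apply: c_ok; rewrite inE.
by apply: colA; rewrite properT; apply/eqP=> /setP/(_ x); rewrite !inE xA.
Qed.

Lemma minimal_inhabited : inhabited G.
Proof.
have [x _|G0] := pickP (@predT G); first by constructor.
by case: (@not_proper_on_full (fun _ => ord0)) => x; have := G0 x.
Qed.

(* Minimal obstructions are cores. *)
Lemma minimal_endo_surj (f : G -> G) x :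
  (forall y z, adj y z -> adj (f y) (f z)) -> exists y, f y = x.
Proof.
move=> f_hom; have [/existsP[y /eqP]|] := boolP [exists y, f y == x].
  by exists y.
rewrite negb_exists => /forallP fx.
(* If [f] misses [x], it maps G into G - x, so a coloring of G - x composed with [f] would color
   G. *)
have [c c_ok] := @minimal_coloring (pred1 x) x (eqxx x).
case: (@not_proper_on_full (c \o f)) => y z _ _ /f_hom adj_f.
by apply: c_ok adj_f; rewrite inE; apply: fx.
Qed.

Lemma uncolorable_copy_full g t :
  copy g t -> colorings g = [::] -> forall x, x \in t.
Proof.
move=> t_g g_col x; apply: contraT => x_t.
have [c c_ok] := @minimal_coloring [predC t] x x_t.
have : [seq val (c y) | y <- t] \in colorings g.
  by apply: coloring_mem t_g _ => y z y_t z_t; apply: c_ok; rewrite !inE negbK.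
by rewrite g_col.
Qed.

(* A pair (u, v) of ps asks to move u onto v. *)
Definition fold_map (ps : seq (nat * nat)) (j : nat) : nat :=
  nth j (unzip2 ps) (index j (unzip1 ps)).

(** All pairs move simultaneously, so a neighbor of [p.1] is compared with [p.2] only after being
    moved itself. Targets are never sources, which keeps the sources out of the image. *)
Definition fold_ok (g : code) (ps : seq (nat * nat)) : bool :=
  (ps != [::]) &&
  all (fun p => [&& p.1 < size g, p.2 < size g, p.2 \notin unzip1 ps
    & all (fun j => code_adj g p.1 j ==> code_adj g p.2 (fold_map ps j))
          (iota 0 (size g))]) ps.

Lemma fold_map_mem ps j : j \in unzip1 ps -> (j, fold_map ps j) \in ps.
Proof.
rewrite /fold_map; elim: ps => //= -[u v] ps IHps; rewrite !inE /=.
by case: eqVneq => [->|] /=; rewrite ?eqxx // => ne /IHps ->; rewrite orbT.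
Qed.

Lemma fold_map_id ps j : j \notin unzip1 ps -> fold_map ps j = j.
Proof.
by move=> j_ps; rewrite /fold_map nth_default // memNindex // !size_map.
Qed.

(** Without such a [w], the fold extended by the identity outside [t] would be an endomorphism of G
    whose image misses the folded vertices. *)
Lemma fold_neighbor g t ps (x0 : G) : copy g t -> fold_ok g ps ->
  exists2 w, w \notin t
    & has (fun p => adj w (nth x0 t p.1) && ~~ adj w (nth x0 t p.2)) ps.
Proof.
move=> t_g /andP[ps_n0 /allP ps_ok].
pose bad w := has (fun p => adj w (nth x0 t p.1) && ~~ adj w (nth x0 t p.2)) ps.
have [/existsP[w /andP[]]|] := boolP [exists w, (w \notin t) && bad w].
  by exists w.
rewrite negb_exists => /forallP no_w.
have sz := encodes_size t_g.
have fm_lt j : j < size g -> fold_map ps j < size g.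
  have [/fold_map_mem|/fold_map_id-> //] := boolP (j \in unzip1 ps).
  by case/ps_ok/and4P.
pose f x := if x \in t then nth x0 t (fold_map ps (index x t)) else x.
have f_out w y : w \notin t -> adj w y -> adj w (f y).
  move=> w_t; rewrite /f; case: ifP => // y_t adj_wy.
  have [j_ps|/fold_map_id->] := boolP (index y t \in unzip1 ps); last first.
    by rewrite nth_index.
  have := no_w w; rewrite w_t => /hasPn/(_ _ (fold_map_mem j_ps)) /=.
  by rewrite nth_index // adj_wy /= negbK.
have f_id w : w \notin t -> f w = w by rewrite /f => /negPf->.
have f_hom y z : adj y z -> adj (f y) (f z).
  have [y_t|y_t] := boolP (y \in t); last by rewrite (f_id y) //; apply: f_out.
  have [z_t|z_t] := boolP (z \in t); last first.
    by rewrite (f_id z) // ![adj _ z]adj_sym; apply: f_out.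
  have i_t : index y t < size g by rewrite -sz index_mem.
  have j_t : index z t < size g by rewrite -sz index_mem.
  rewrite /f y_t z_t -(copy_code_adj _ t_g) ?fm_lt //.
  rewrite -{1}(nth_index x0 y_t) -{1}(nth_index x0 z_t).
  rewrite -(copy_code_adj _ t_g) //.
  move: (index y t) (index z t) i_t j_t => i j i_t j_t adj_ij.
  (* An edge with a moved endpoint is covered by [fold_ok]; by symmetry either endpoint may play
     that part. *)
  have key k l : l < size g -> k \in unzip1 ps -> code_adj g k l ->
      code_adj g (fold_map ps k) (fold_map ps l).
    move=> l_g /fold_map_mem/ps_ok/and4P[_ _ _ /allP/(_ l)].
    by rewrite mem_iota add0n => /(_ l_g)/implyP.
  have [i_ps|i_ps] := boolP (i \in unzip1 ps); first exact: key.
  have [j_ps|j_ps] := boolP (j \in unzip1 ps); last by rewrite !fold_map_id.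
  by rewrite code_adj_sym key // code_adj_sym.
(* The source [u] of the first pair is never a value of [f], contradicting surjectivity. *)
case: ps ps_n0 => // -[u v] ps _ in ps_ok fm_lt f f_out f_id f_hom {bad no_w} *.
have u_g : u < size g by case/and4P: (ps_ok (u, v) (mem_head _ _)).
have [y fy] := minimal_endo_surj (nth x0 t u) f_hom; exfalso.
have u_t : nth x0 t u \in t by rewrite mem_nth // sz.
move: fy; rewrite /f; case: ifP => [y_t /eqP|y_t def_y]; last first.
  by rewrite def_y u_t in y_t.
have j_t : index y t < size g by rewrite -sz index_mem.
rewrite nth_uniq ?sz ?fm_lt ?(encodes_uniq t_g) // => /eqP def_u.
set ps' := (u, v) :: ps in ps_ok def_u *.
have u_ps : u \in unzip1 ps' by rewrite mem_head.
have [/fold_map_mem|j_ps] := boolP (index y t \in unzip1 ps').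
  by case/ps_ok/and4P=> _ _ /negP[]; rewrite def_u.
by case/negP: (j_ps); rewrite -(fold_map_id j_ps) def_u.
Qed.

(** The set X to be recolored consists of the first [m] vertices. With [m = size g] the test says
    that [g] is colorable, and the rule then expresses connectivity. *)
Definition extend_ok (g : code) (m : nat) : bool :=
  (0 < m <= size g) &&
  all (fun cs => extensions (take m g) cs != [::]) (colorings (drop m g)).

(** If X had no neighbor outside [t], a coloring of G - X could be changed on X alone into a
    coloring of G. *)
Lemma extend_neighbor g t m : copy g t -> extend_ok g m ->
  exists2 w, w \notin t & has (adj w) (take m t).
Proof.
move=> t_g /andP[/andP[m_gt0 m_g] /allP m_ok].
pose near w := (w \notin t) && has (adj w) (take m t).
have [/existsP[w /andP[]]|] := boolP [exists w, near w]; first by exists w.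
rewrite negb_exists => /forallP no_w; exfalso.
have sz := encodes_size t_g.
have [x x_t] : exists x, x \in take m t.
  have : 0 < size (take m t) by rewrite size_takel ?sz.
  by case: (take m t) => // x s _; exists x; rewrite mem_head.
have [c c_ok] := minimal_coloring x_t.
have t_uniq := encodes_uniq t_g.
have dropP y : y \in drop m t -> y \notin take m t.
  move: t_uniq; rewrite -{1}(cat_take_drop m t) cat_uniq.
  by case/and3P=> _ /hasPn no_y _; apply: no_y.
have c_drop : proper_on (mem (drop m t)) c.
  by move=> y z /dropP yP /dropP zP; apply: c_ok.
have /m_ok := coloring_mem (encodes_drop m t_g) c_drop.
case def_ds: (extensions _ _) => [|ds dss] // _.
have [||||c' [c'_c c'_ok _]] := @extension_coloring G (take m g) (drop m g)
    (take m t) (drop m t) c ds.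
- by rewrite !size_takel ?sz.
- by rewrite !cat_take_drop.
- exact: c_drop.
- by rewrite def_ds mem_head.
apply: (@not_proper_on_full c') => y z _ _ adj_yz.
rewrite cat_take_drop in c'_ok.
(* Every edge lies inside [t], where [c'] is proper, or avoids X, where [c'] equals [c]. *)
have out w u : w \notin t -> adj w u -> u \notin take m t.
  move=> w_t adj_wu; apply/negP=> u_t; have := no_w w.
  by rewrite /near w_t => /hasPn/(_ u u_t); rewrite adj_wu.
have notake w : w \notin t -> w \notin take m t.
  by apply: contra; apply: mem_take.
have c'_out u v : u \notin take m t -> v \notin take m t -> adj u v ->
    C5_adj (c' u) (c' v).
  move=> uP vP adj_uv; rewrite !c'_c ?inE //.
  by apply: c_ok adj_uv; rewrite !inE.
have [y_t|y_t] := boolP (y \in t); last first.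
  by apply: c'_out (adj_yz); [apply: notake | apply: out adj_yz].
have [z_t|z_t] := boolP (z \in t); first exact: c'_ok.
by apply: c'_out (adj_yz); [apply: out z_t _; rewrite adj_sym | apply: notake].
Qed.

End Minimal.

(** * Certificates *)

Inductive rule := Fold of seq (nat * nat) | Extend of nat.

Definition rule_ok (g : code) (rl : rule) : bool :=
  match rl with Fold ps => fold_ok g ps | Extend m => extend_ok g m end.

Definition rule_row (rl : rule) (r : seq bool) : bool :=
  match rl with
  | Fold ps => has (fun p => nth false r p.1 && ~~ nth false r p.2) ps
  | Extend m => has id (take m r)
  end.

Fixpoint bitseqs (n : nat) : seq (seq bool) :=
  if n is n'.+1 then
    map (cons true) (bitseqs n') ++ map (cons false) (bitseqs n')
  else [:: [::]].

Lemma mem_bitseqs r : r \in bitseqs (size r).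
Proof.
elim: r => //= b r IHr; rewrite mem_cat.
by case: b; rewrite map_f ?orbT.
Qed.

(** [base] holds the graphs already settled. The case tree is read from the leaves towards the root:
    an entry may use only [base] and earlier entries, and then joins them. *)
Fixpoint certifies (base : seq code) (cert : seq (code * rule)) : bool :=
  if cert is (g, rl) :: cert' then
    [&& rule_ok g rl,
        all (fun r => rule_row rl r ==> has (contains^~ (r :: g)) base)
            (bitseqs (size g))
      & certifies (rcons base g) cert']
  else true.

Lemma rule_sound (G : sgraph) g rl (t : seq G) :
    minimal_obstruction C5 G -> encodes (@adj G) g t -> rule_ok g rl ->
  exists2 w, w \notin t & rule_row rl [seq adj w x | x <- t].
Proof.
move=> G_min t_g; case: rl => [ps|m] /=; last first.
  case/(extend_neighbor G_min t_g) => w w_t w_m; exists w => //.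
  by rewrite -map_take has_map.
have [x0] := minimal_inhabited G_min => ps_ok.
have [w w_t /hasP[p p_ps p_w]] := fold_neighbor G_min x0 t_g ps_ok.
exists w => //; apply/hasP; exists p => //.
case/andP: ps_ok => _ /allP/(_ _ p_ps)/and4P[p1 p2 _ _].
by rewrite !(nth_map x0) ?(encodes_size t_g).
Qed.

(** The rule gives a vertex [w] outside the copy of [g]; the enlarged copy contains a settled graph,
    hence [Q]. *)
Lemma certifies_sound (G : sgraph) (Q : Prop) base cert :
    minimal_obstruction C5 G -> certifies base cert ->
    {in base, forall h, forall t : seq G, encodes (@adj G) h t -> Q} ->
  {in unzip1 cert, forall h, forall t : seq G, encodes (@adj G) h t -> Q}.
Proof.
move=> G_min; elim: cert base => [|[g rl] cert IHcert] base //=.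
case/and3P=> rl_ok /allP g_ok cert_ok baseQ.
have gQ (t : seq G) : encodes (@adj G) g t -> Q.
  move=> t_g; have [w w_t w_rl] := rule_sound G_min t_g rl_ok.
  set r := [seq _ | x <- t] in w_rl.
  have r_bits : r \in bitseqs (size g).
    by rewrite -(encodes_size t_g) -(size_map (adj w)) mem_bitseqs.
  have /hasP[h h_base] := implyP (g_ok _ r_bits) w_rl.
  have wt_rg : encodes (@adj G) (r :: g) (w :: t).
    by rewrite encodes_cons eqxx w_t.
  by case/(contains_copy w wt_rg)=> t'; apply: baseQ.
move=> h; rewrite inE => /predU1P[-> //|]; apply: IHcert cert_ok _ _.
by move=> h'; rewrite mem_rcons inE => /predU1P[-> //|]; apply: baseQ.
Qed.

(** * From certificates to the count up to isomorphism *)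

Definition critical (g : code) : bool :=
  (colorings g == [::]) &&
  all (fun i => colorings (encode (code_adj g)
                             [seq j <- iota 0 (size g) | j != i]) != [::])
      (iota 0 (size g)).

(** Single-vertex deletions suffice: a proper subset misses some [x], and a coloring of the graph
    without [x] restricts to it. *)
Lemma critical_minimal g :
    encode (code_adj g) (iota 0 (size g)) == g -> critical g ->
  minimal_obstruction C5 (decode g).
Proof.
move=> /encode_decode g_g /andP[/eqP g_col /allP g_crit]; split=> [[c c_ok]|S].
  have : [seq val (c x) | x <- enum 'I_(size g)] \in colorings g.
    by apply: (@coloring_mem (decode g) g _ c g_g) => x y _ _; apply: c_ok.
  by rewrite g_col.
rewrite properT => /eqP S_T.
have [x xS] : exists x, x \notin S.
  apply/existsP; rewrite -negb_forall; apply/negP=> /forallP S_full.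
  by apply: S_T; apply/setP=> x; rewrite inE S_full.
apply/colorable_inducedP.
pose t : seq (decode g) := [seq y <- enum 'I_(size g) | y != x].
set h := encode (@adj (decode g)) t.
have t_h : encodes (@adj (decode g)) (h ++ [::]) (t ++ [::]).
  by rewrite !cats0 /encodes eqxx filter_uniq ?enum_uniq.
have def_h : h = encode (code_adj g) 
    [seq j <- iota 0 (size g) | j != (x : 'I_(size g)) :> nat].
  apply/esym/eqP; rewrite -val_enum_ord filter_map.
  have := t_h; rewrite !cats0 -(@encodes_map _ _ _ (code_adj g) val).
  - by case/andP.
  - by move=> ? ? _ _ /val_inj.
  - by [].
have := g_crit x; rewrite mem_iota ltn_ord -def_h => /(_ isT).
case def_ds: (colorings h) => [|ds dss] // _.
have [||||c [_ c_ok _]] := @extension_coloring _ h [::] t [::] (fun=> ord0) ds.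
- by have := encodes_size t_h; rewrite !cats0.
- exact: t_h.
- by [].
- by rewrite -[extensions _ _]/(colorings h) def_ds mem_head.
exists c => y z yS zS; apply: c_ok; rewrite cats0 mem_filter mem_enum andbT.
  by apply: contraNneq xS => <-.
by apply: contraNneq xS => <-.
Qed.

Definition K3_code : code := [:: [:: true; true]; [:: true]; [::]].

(** Excluding earlier graphs from later ones is enough for non-isomorphism, because isomorphism is
    symmetric. The code [[:: [::]]] is the one-vertex graph, the root of the case tree. *)
Definition classifies (sp : code) (obs : seq code) (cert : seq (code * rule)) :=
  [&& all (fun g => [&& encode (code_adj g) (iota 0 (size g)) == g,
                       critical g & ~~ contains sp g]) (K3_code :: obs),
      pairwise (fun g h => ~~ contains g h) (K3_code :: obs),
      [:: [::]] \in unzip1 cert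
    & certifies [:: K3_code, sp & obs] cert].

Lemma classification (F : sgraph) (t0 : seq F) sp obs cert :
    encodes (@adj F) sp t0 -> (forall x, x \in t0) -> classifies sp obs cert ->
  exactly_up_to_iso (size (K3_code :: obs))
    (fun G => free_of F G /\ minimal_obstruction C5 G).
Proof.
move=> t0_sp t0_full /and4P[/allP obs_ok /pairwiseP obs_neq K1_cert cert_ok].
pose ob i := nth K3_code (K3_code :: obs) i.
have obP i : i < size (K3_code :: obs) -> ob i \in K3_code :: obs.
  exact: mem_nth.
have self g : g \in K3_code :: obs ->
    encodes (@adj (decode g)) g (enum 'I_(size g)).
  by case/obs_ok/and3P=> /encode_decode.
have full g (x : decode g) : x \in enum 'I_(size g) by rewrite mem_enum.
exists (fun i : 'I_(size (K3_code :: obs)) => decode (ob i)); split.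
- move=> i; have /obs_ok/and3P[g_ok g_crit g_free] := obP i (ltn_ord i).
  split; last exact: critical_minimal.
  apply/(free_ofP _ t0_sp t0_full) => t; apply: contra g_free.
  exact: copy_contains (self _ (obP i (ltn_ord i))) (full _).
- have key (i j : 'I_(size (K3_code :: obs))) :
      isomorphic (decode (ob i)) (decode (ob j)) -> ~~ (i < j).
    case/isomorphic_copy/(_ (self _ (obP i (ltn_ord i)))) => t.
    move/(copy_contains (self _ (obP j (ltn_ord j))) (full _)) => ij.
    by apply/negP=> /(obs_neq K3_code _ _ (ltn_ord i) (ltn_ord j)); rewrite ij.
  move=> i j iso_ij; apply: val_inj; apply/eqP; rewrite eqn_leq.
  by rewrite (leqNgt i) (leqNgt j) !key //; apply: isomorphic_sym.
- move=> G [/(free_ofP _ t0_sp t0_full) no_sp G_min].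
  have obsQ g (t : seq G) : g \in K3_code :: obs -> encodes (@adj G) g t ->
      exists i : 'I_(size (K3_code :: obs)), isomorphic G (decode (ob i)).
    move=> g_obs t_g; have := g_obs; rewrite -index_mem => i_lt.
    exists (Ordinal i_lt); rewrite /ob nth_index //.
    apply: full_copy_iso (t_g) _; apply: uncolorable_copy_full t_g _ => //.
    by case/obs_ok/and3P: g_obs => _ /andP[/eqP].
  have [x] := minimal_inhabited G_min.
  (* Any vertex of G is a copy of the root. At the leaves, the spider is excluded by freeness and a
     listed graph must be all of G. *)
  apply: (certifies_sound G_min cert_ok _ K1_cert (t := [:: x])) => // g.
  rewrite !inE => /or3P[/eqP->|/eqP->|g_obs] t t_g.
  + by apply: obsQ t_g; rewrite mem_head.
  + by have := no_sp t; rewrite t_g.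
  + by apply: obsQ t_g; rewrite inE g_obs orbT.
Qed.

(** * The two classifications *)

(* Entry i of l lists the neighbours of i that are larger than i. *)
Definition of_nbrs (l : seq (seq nat)) : code :=
  encode (fun i j => j \in nth [::] l i) (iota 0 (size l)).

Definition spider_221 : code :=
  of_nbrs [:: [:: 1]; [:: 5]; [:: 3]; [:: 5]; [:: 5]; [::]].

(** The triangle is added by [classifies]. The 8-vertex graph is the Wagner graph (the Möbius ladder
    on 8 vertices), which also heads [obstructions_311]. *)
Definition obstructions_221 : seq code :=
  [seq of_nbrs l | l <- [::
    [:: [:: 1; 3; 7]; [:: 2; 5]; [:: 3; 6]; [:: 4]; [:: 5; 7]; [:: 6]; [::
      7]; [::]];
    [:: [:: 1; 3; 10; 12]; [:: 2; 4; 6]; [:: 3; 5; 12]; [:: 4; 9]; [:: 5;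
      7]; [:: 6; 8]; [:: 7; 11]; [:: 8; 10]; [:: 9; 11]; [:: 10; 12]; [::
      11]; [:: 12]; [::]]]].

Definition certificate_221 : seq (code * rule) :=
  [seq (of_nbrs p.1, p.2) | p <- [::
    ([:: [:: 2; 3; 5]; [:: 2; 3; 8]; [:: 4; 11]; [:: 4; 6]; [:: 5; 9]; [::
       6; 10]; [:: 7; 9]; [:: 8; 10]; [:: 9; 11]; [:: 10]; [:: 11]; [::]],
     Fold [:: (7, 9)]);
    ([:: [:: 1; 3; 5]; [:: 2; 4]; [:: 3; 9]; [:: 8]; [:: 6; 9]; [:: 6; 8];
       [:: 7; 10]; [:: 8; 9]; [:: 10]; [:: 10]; [::]],
     Fold [:: (10, 7)]);
    ([:: [:: 1; 3; 4]; [:: 2; 9]; [:: 4; 7]; [:: 6; 9]; [:: 5; 8]; [:: 6;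
       7]; [:: 8; 10]; [:: 8; 10]; [:: 9]; [:: 10]; [::]],
     Fold [:: (10, 8)]);
    ([:: [:: 1; 3; 5]; [:: 2; 7]; [:: 3; 8]; [:: 4]; [:: 5; 9]; [:: 6]; [::
       7; 9]; [:: 8]; [:: 9]; [::]],
     Extend 10);
    ([:: [:: 1; 3; 9]; [:: 2; 7]; [:: 3; 4]; [:: 8]; [:: 5; 7]; [:: 6; 8];
       [:: 7; 9]; [:: 8]; [:: 9]; [::]],
     Fold [:: (5, 7)]);
    ([:: [:: 2; 3]; [:: 2; 5]; [:: 4]; [:: 4; 7]; [:: 6]; [:: 6; 8]; [::
       7]; [:: 8]; [::]],
     Fold [:: (8, 6)]);
    ([:: [:: 1; 7]; [:: 2; 4]; [:: 3; 6]; [:: 4; 5]; [:: 7]; [:: 6; 8]; [::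
       7]; [:: 8]; [::]],
     Fold [:: (8, 6)]);
    ([:: [:: 1; 3]; [:: 6]; [:: 3; 4]; [:: 5]; [:: 5; 7]; [:: 6]; [:: 7];
       [::]],
     Fold [:: (7, 5)]);
    ([:: [:: 1; 2]; [:: 3; 5]; [:: 3; 6]; [:: 4]; [:: 5; 7]; [:: 6]; [::
       7]; [::]],
     Fold [:: (7, 5)]);
    ([:: [:: 1; 2]; [:: 4]; [:: 5]; [:: 4; 6]; [:: 5]; [:: 6]; [::]],
     Fold [:: (6, 4)]);
    ([:: [:: 2; 4]; [:: 2; 3]; [:: 5]; [:: 4; 6]; [:: 5]; [:: 6]; [::]],
     Fold [:: (6, 4)]);
    ([:: [:: 4]; [:: 2; 5]; [:: 3]; [:: 4]; [:: 5]; [::]],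
     Fold [:: (0, 5)]);
    ([:: [:: 1; 4]; [:: 3]; [:: 3; 4]; [:: 5]; [:: 5]; [::]],
     Fold [:: (5, 2)]);
    ([:: [:: 1; 4]; [:: 2]; [:: 3]; [:: 4]; [::]], Extend 5);
    ([:: [:: 3]; [:: 4]; [:: 3; 5]; [:: 4]; [:: 5]; [::]],
     Fold [:: (1, 5)]);
    ([:: [:: 2]; [:: 3]; [:: 3]; [:: 4]; [::]], Fold [:: (4, 1)]);
    ([:: [:: 1; 3; 7]; [:: 2; 6]; [:: 3; 5]; [:: 4]; [:: 5; 7]; [:: 6]; [::
       7]; [::]],
     Fold [:: (7, 3); (6, 2)]);
    ([:: [:: 2; 5]; [:: 2; 3]; [:: 4]; [:: 4; 6]; [:: 5]; [:: 6]; [::]],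
     Fold [:: (6, 4)]);
    ([:: [:: 1; 3]; [:: 4]; [:: 3; 5]; [:: 4]; [:: 5]; [::]],
     Fold [:: (5, 3)]);
    ([:: [:: 3]; [:: 2; 4]; [:: 3]; [:: 4]; [::]], Fold [:: (4, 2)]);
    ([:: [:: 2]; [:: 2]; [:: 3]; [::]], Fold [:: (3, 1)]);
    ([:: [:: 1; 2]; [:: 4]; [:: 3]; [::]; [::]], Extend 3);
    ([:: [:: 1]; [:: 2]; [:: 3]; [::]], Fold [:: (3, 1)]);
    ([:: [:: 1]; [:: 2]; [::]], Fold [:: (2, 0)]);
    ([:: [:: 1]; [::]], Extend 2);
    ([:: [::]], Extend 1)]].

Definition spider_311 : code :=
  of_nbrs [:: [:: 1]; [:: 2]; [:: 5]; [:: 5]; [:: 5]; [::]].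

Definition obstructions_311 : seq code :=
  [seq of_nbrs l | l <- [::
    [:: [:: 1; 3; 7]; [:: 2; 5]; [:: 3; 6]; [:: 4]; [:: 5; 7]; [:: 6]; [::
      7]; [::]];
    [:: [:: 3; 5]; [:: 2; 4]; [:: 3; 6]; [:: 7]; [:: 5; 7]; [:: 6]; [:: 7];
      [::]];
    [:: [:: 2; 5]; [:: 2; 6]; [:: 4]; [:: 4; 5]; [:: 7]; [:: 6]; [:: 7];
      [::]];
    [:: [:: 1; 6]; [:: 5]; [:: 3; 7]; [:: 4]; [:: 5; 6]; [:: 7]; [:: 7];
      [::]]]].

Definition certificate_311 : seq (code * rule) :=
  [seq (of_nbrs p.1, p.2) | p <- [::
    ([:: [:: 1; 4]; [:: 7]; [:: 3; 5]; [:: 7]; [:: 6; 8]; [:: 6; 8]; [::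
       7]; [:: 8]; [::]],
     Fold [:: (8, 6)]);
    ([:: [:: 1; 2]; [:: 5]; [:: 6]; [:: 4; 7]; [:: 5]; [:: 6]; [:: 7];
       [::]],
     Extend 8);
    ([:: [:: 1]; [:: 5]; [:: 3; 6]; [:: 4]; [:: 5]; [:: 6]; [::]],
     Fold [:: (0, 5)]);
    ([:: [:: 1; 5]; [:: 4]; [:: 3; 5]; [:: 4]; [:: 6]; [:: 6]; [::]],
     Fold [:: (3, 1); (2, 0)]);
    ([:: [:: 1; 2]; [:: 4]; [:: 5]; [:: 4; 6]; [:: 5]; [:: 6]; [::]],
     Fold [:: (6, 4)]);
    ([:: [:: 2; 4]; [:: 2; 3]; [:: 5]; [:: 4; 6]; [:: 5]; [:: 6]; [::]],
     Fold [:: (6, 4)]);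
    ([:: [:: 4]; [:: 2; 5]; [:: 3]; [:: 4]; [:: 5]; [::]],
     Fold [:: (0, 5)]);
    ([:: [:: 1; 4]; [:: 3]; [:: 3; 4]; [:: 5]; [:: 5]; [::]],
     Fold [:: (5, 2)]);
    ([:: [:: 1; 4]; [:: 2]; [:: 3]; [:: 4]; [::]], Extend 5);
    ([:: [:: 2]; [:: 3]; [:: 3]; [:: 4]; [::]], Fold [:: (0, 3)]);
    ([:: [:: 1; 3; 7]; [:: 2; 6]; [:: 3; 5]; [:: 4]; [:: 5; 7]; [:: 6]; [::
       7]; [::]],
     Fold [:: (7, 3); (6, 2)]);
    ([:: [:: 2; 5]; [:: 2; 3]; [:: 4]; [:: 4; 6]; [:: 5]; [:: 6]; [::]],
     Fold [:: (6, 4)]);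
    ([:: [:: 1; 3]; [:: 4]; [:: 3; 5]; [:: 4]; [:: 5]; [::]],
     Fold [:: (5, 3)]);
    ([:: [:: 3]; [:: 2; 4]; [:: 3]; [:: 4]; [::]], Fold [:: (4, 2)]);
    ([:: [:: 2]; [:: 2]; [:: 3]; [::]], Fold [:: (3, 1)]);
    ([:: [:: 1; 2]; [:: 4]; [:: 3]; [::]; [::]], Extend 3);
    ([:: [:: 1]; [:: 2]; [:: 3]; [::]], Fold [:: (3, 1)]);
    ([:: [:: 1]; [:: 2]; [::]], Fold [:: (2, 0)]);
    ([:: [:: 1]; [::]], Extend 2);
    ([:: [::]], Extend 1)]].

(* lazy short-circuits has, all and &&; call-by-value evaluation would        *)
(* explore every branch of the searches.                                      *)
Lemma classifies_221 : classifies spider_221 obstructions_221 certificate_221.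
Proof. by lazy. Qed.

Lemma classifies_311 : classifies spider_311 obstructions_311 certificate_311.
Proof. by lazy. Qed.

Theorem theorem2 :
  exactly_up_to_iso 3
    (fun G : sgraph => free_of (S_graph 2 2 1) G /\ minimal_obstruction C5 G) /\
  exactly_up_to_iso 5
    (fun G : sgraph => free_of (S_graph 3 1 1) G /\ minimal_obstruction C5 G).
Proof.
split.
(* Each leg is listed from its tip inwards and the center comes last, matching the numbering in
   [spider_221]. *)
- pose t0 : seq (S_graph 2 2 1) :=
    [:: Some (inl (inl (@Ordinal 2 1 isT)));
        Some (inl (inl (@Ordinal 2 0 isT)));
        Some (inl (inr (@Ordinal 2 1 isT)));
        Some (inl (inr (@Ordinal 2 0 isT)));
        Some (inr (@Ordinal 1 0 isT)); None].
  apply: (classification (t0 := t0) _ _ classifies_221) => //.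
  by move=> [[[[[|[|]]]|[[|[|]]]]|[[|]]]|].
- pose t0 : seq (S_graph 3 1 1) :=
    [:: Some (inl (inl (@Ordinal 3 2 isT)));
        Some (inl (inl (@Ordinal 3 1 isT)));
        Some (inl (inl (@Ordinal 3 0 isT)));
        Some (inl (inr (@Ordinal 1 0 isT)));
        Some (inr (@Ordinal 1 0 isT)); None].
  apply: (classification (t0 := t0) _ _ classifies_311) => //.
  by move=> [[[[[|[|[|]]]]|[[|]]]|[[|]]]|].
Qed.
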